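(* Let $(A,[\ ,\ ])$ be a Malcev algebra over $\mathbb{K}$ and let $\alpha_t$ be an algebra endomorphism of $(A,[\ ,\ ])$ of the form $\alpha_t=\mathrm{id}+\sum_{i=1}^{p}t^i\alpha_i$, where the $\alpha_i$ are linear maps on $A$, $t$ is a parameter in $\mathbb{K}$ and $p$ is an integer. Let $[\ ,\ ]_t=\alpha_t\circ[\ ,\ ]$. Then $(A,[\ ,\ ]_t,\alpha_t)$ is a Hom-Malcev algebra which is a deformation of the Malcev algebra viewed as the Hom-Malcev algebra $(A,[\ ,\ ],\mathrm{id})$. Moreover, for every $n\ge0$, the $n$th derived Hom-algebra of type 2, $$A_t^n=\left(A,\ [\ ,\ ]_t^{(n)}=\alpha_t^{2^n-1}\circ[\ ,\ ]_t,\ \alpha_t^{2^n}\right),$$ is a deformation of $(A,[\ ,\ ],\mathrm{id})$.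
   Context: $\mathbb{K}$ is an algebraically closed field of characteristic zero. A Hom-Malcev algebra is a triple $(A,[\ ,\ ],\alpha)$ where $A$ is a $\mathbb{K}$-vector space, $[\ ,\ ]:A\times A\to A$ is a skewsymmetric bilinear map and $\alpha:A\to A$ is a linear map satisfying, for all $x,y,z\in A$, $$J_\alpha(\alpha(x),\alpha(y),[x,z])=[J_\alpha(x,y,z),\alpha^2(x)],$$ where $J_\alpha(x,y,z)=[[x,y],\alpha(z)]+[[y,z],\alpha(x)]+[[z,x],\alpha(y)]$ is the Hom-Jacobiator. A Malcev algebra is the case $\alpha=\mathrm{id}$. That $\alpha_t$ is an algebra endomorphism means $\alpha_t([x,y])=[\alpha_t(x),\alpha_t(y)]$ for all $x,y\in A$, as an identity in the parameter $t$. Powers of $\alpha_t$ denote iterated composition. A (Hom-Malcev 1-parameter formal) deformation of a Hom-Malcev algebra $(A,[\ ,\ ]_0,\alpha_0)$ is given by a $\mathbb{K}[[t]]$-bilinear map $[\ ,\ ]_t=\sum_{i\ge0}[\ ,\ ]_i t^i$ and a $\mathbb{K}[[t]]$-linear map $\alpha_t=\sum_{i\ge0}\alpha_i t^i$ on $A[[t]]$, where each $[\ ,\ ]_i:A\times A\to A$ is $\mathbb{K}$-bilinear and each $\alpha_i:A\to A$ is $\mathbb{K}$-linear (extended over $\mathbb{K}[[t]]$), whose degree-zero terms are the given $[\ ,\ ]_0$ and $\alpha_0$, such that for all $x,y,z\in A$ $$J_{\alpha_t}(\alpha_t(x),\alpha_t(y),[x,z]_t)=[J_{\alpha_t}(x,y,z),\alpha_t^2(x)]_t,$$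 where $J_{\alpha_t}(x,y,z)=[[x,y]_t,\alpha_t(z)]_t+[[y,z]_t,\alpha_t(x)]_t+[[z,x]_t,\alpha_t(y)]_t$. *)

(* Defs.v *)
From mathcomp Require Import all_boot all_order all_algebra.
From mathcomp Require Export boolp functions.

Set Implicit Arguments.
Unset Strict Implicit.
Unset Printing Implicit Defensive.

Import GRing.Theory.
Local Open Scope ring_scope.

(* Hom-Jacobiator and Hom-Malcev identity only use addition, so they are stated
   over an additive group V; they are used both for V = A and for V = A[[t]]. *)
Definition hom_jacobiator (V : zmodType) (br : V -> V -> V) (al : V -> V)
    (x y z : V) : V :=
  br (br x y) (al z) + br (br y z) (al x) + br (br z x) (al y).

Definition hom_malcev_identity (V : zmodType) (br : V -> V -> V) (al : V -> V)
    (x y z : V) : Prop :=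
  hom_jacobiator br al (al x) (al y) (br x z) =
  br (hom_jacobiator br al x y z) (al (al x)).

Definition skewsymmetric (V : zmodType) (br : V -> V -> V) : Prop :=
  forall x y : V, br x y = - br y x.

Record is_hom_malcev (K : fieldType) (A : lmodType K)
    (br : A -> A -> A) (al : A -> A) : Prop := IsHomMalcev {
  hom_malcev_bilinear : bilinear_for *:%R *:%R br;
  hom_malcev_skew : skewsymmetric br;
  hom_malcev_linear : linear al;
  hom_malcevP : forall x y z : A, hom_malcev_identity br al x y z
}.

Definition is_malcev (K : fieldType) (A : lmodType K) (br : A -> A -> A) : Prop :=
  is_hom_malcev br id.

(* A[[t]]: the sequence f stands for \sum_i f i t^i; addition is pointwise. *)
Notation fseries A := (nat -> A) (only parsing).

Definition fseries_const (A : zmodType) (x : A) : fseries A :=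
  fun k => if k == 0%N then x else 0.

(* The K[[t]]-linear map \sum_i al i t^i on A[[t]]. *)
Definition fseries_lin (A : zmodType) (al : nat -> A -> A)
    (f : fseries A) : fseries A :=
  fun k => \sum_(i < k.+1) al i (f (k - i)%N).

(* The K[[t]]-bilinear map \sum_i br i t^i on A[[t]]: the coefficient of t^k is
   the sum of br i (f j) (g l) over i + j + l = k. *)
Definition fseries_bilin (A : zmodType) (br : nat -> A -> A -> A)
    (f g : fseries A) : fseries A :=
  fun k => \sum_(i < k.+1) \sum_(j < (k - i).+1) br i (f j) (g (k - i - j)%N).

(* The K[[t]]-bilinear extension to A[[t]] of a single bilinear map on A. *)
Definition fseries_bilin_ext (A : zmodType) (br : A -> A -> A) :
    fseries A -> fseries A -> fseries A :=
  fseries_bilin (fun i x y => if i == 0%N then br x y else 0).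

(* The defining identity is required for x, y, z in A, i.e. constant series. *)
Record is_deformation (K : fieldType) (A : lmodType K)
    (br0 : A -> A -> A) (al0 : A -> A)
    (brt : fseries A -> fseries A -> fseries A) (alt : fseries A -> fseries A) :
    Prop := IsDeformation {
  deformation_base : is_hom_malcev br0 al0;
  deformation_bracket : exists br : nat -> A -> A -> A,
    [/\ forall i, bilinear_for *:%R *:%R (br i),
        forall x y, br 0%N x y = br0 x y
      & forall f g, brt f g = fseries_bilin br f g];
  deformation_twist : exists al : nat -> A -> A,
    [/\ forall i, linear (al i),
        forall x, al 0%N x = al0 x
      & forall f, alt f = fseries_lin al f];
  deformation_skew : skewsymmetric brt;
  deformationP : forall x y z : A,
    hom_malcev_identity brt alt
      (fseries_const x) (fseries_const y) (fseries_const z)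
}.

(* alpha_t = id + \sum_(1 <= i <= p) t^i alpha_i, at a value t of the parameter. *)
Definition alpha_at (K : fieldType) (A : lmodType K) (p : nat)
    (al : nat -> A -> A) (t : K) (x : A) : A :=
  x + \sum_(1 <= i < p.+1) t ^+ i *: al i x.

(* The same alpha_t as a K[[t]]-linear map on A[[t]]. *)
Definition alpha_formal (A : zmodType) (p : nat) (al : nat -> A -> A) :
    fseries A -> fseries A :=
  fseries_lin (fun i x =>
    if i == 0%N then x else if (i <= p)%N then al i x else 0).

Definition twisted_bracket (V : Type) (al : V -> V) (br : V -> V -> V) :
    V -> V -> V :=
  fun x y => al (br x y).

(* Bracket and twisting map of the n-th derived Hom-algebra of type 2. *)
Definition derived2_bracket (V : Type) (n : nat) (br : V -> V -> V)
    (al : V -> V) : V -> V -> V :=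
  fun x y => iter (2 ^ n - 1) al (br x y).

Definition derived2_twist (V : Type) (n : nat) (al : V -> V) : V -> V :=
  iter (2 ^ n) al.

(* Main.v *)
From HB Require Import structures.
Require Import Defs.
From mathcomp Require Import all_boot all_order all_algebra.

(** Write [T] for the formal map [alpha_formal p al] on A[[t]]. Every bracket
    and twist in the statement has the form (T^m o [,], T^m), with m = 1 for the
    basic deformation and m = 2^n for the n-th derived Hom-algebra, so one
    argument treats all of them.

    - Over A: if [be] is a linear endomorphism of a Malcev algebra, then
      [be o [,]] and [be] satisfy the Hom-Malcev identity, because each side is
      [be^3] applied to the corresponding side of the Malcev identity
      ([twist_hom_malcev]). This applies to alpha_t and to its iterates, at
      every value t of the parameter.

    - Over A[[t]]: the Hom-Malcev identity is only required on constant series.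
      All the series it involves are then polynomials in t, and a polynomial is
      determined by its values, since K is infinite ([coefs_of_inj]). Evaluation
      at t carries the extended bracket to the bracket of A and T to alpha_t
      ([coefs_of_bracket], [coefs_of_alpha_formal]); hence the formal identity
      evaluates, at each t, to the identity already known in A.

    What remains is that T^m and T^m o [,] have the shape of a K[[t]]-linear and
    a K[[t]]-bilinear map with the right constant term. This is closure of such
    maps under composition, by Cauchy products ([fseries_lin_comp]). *)

Set Implicit Arguments.
Unset Strict Implicit.
Unset Printing Implicit Defensive.

Import GRing.Theory.
Local Open Scope ring_scope.

(** * Linear maps given as unbundled functions *)

Section Linear.
Variables (K : fieldType) (A : lmodType K).

(** Gives a map known only by a proof of linearity access to the theory of
    bundled morphisms; the next lemmas export what is used of it. *)
Lemma linear_bundle (f : A -> A) : linear f -> exists g : {linear A -> A}, f = g.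
Proof.
move=> f_lin.
pose m := GRing.isLinear.Build K A A *:%R f f_lin.
pose g : {linear A -> A} := HB.pack f m.
by exists g.
Qed.

Lemma linear_fun0 (f : A -> A) : linear f -> f 0 = 0.
Proof. by case/linear_bundle=> g ->; rewrite raddf0. Qed.

Lemma linear_funD (f : A -> A) : linear f -> {morph f : x y / x + y}.
Proof. by case/linear_bundle=> g -> x y; rewrite raddfD. Qed.

Lemma linear_funN (f : A -> A) : linear f -> {morph f : x / - x}.
Proof. by case/linear_bundle=> g -> x; rewrite raddfN. Qed.

Lemma linear_funZ (f : A -> A) (a : K) : linear f -> {morph f : x / a *: x}.
Proof. by case/linear_bundle=> g -> x; rewrite linearZ. Qed.

Lemma linear_fun_sum (f : A -> A) (I : Type) (r : seq I) (P : pred I)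
    (F : I -> A) :
  linear f -> f (\sum_(i <- r | P i) F i) = \sum_(i <- r | P i) f (F i).
Proof. by case/linear_bundle=> g ->; rewrite raddf_sum. Qed.

Lemma linear_sum_fun (I : Type) (r : seq I) (P : pred I) (F : I -> A -> A) :
  (forall i, P i -> linear (F i)) ->
  linear (fun x => \sum_(i <- r | P i) F i x).
Proof.
move=> F_lin a x y; rewrite scaler_sumr -big_split.
by apply: eq_bigr => i /F_lin ->.
Qed.

Lemma linear_comp (f g : A -> A) : linear f -> linear g -> linear (f \o g).
Proof. by move=> f_lin g_lin a x y; rewrite /= g_lin f_lin. Qed.

Lemma linear_iter (f : A -> A) m : linear f -> linear (iter m f).
Proof. by move=> f_lin; elim: m => // m IH a x y; rewrite /= IH f_lin. Qed.

End Linear.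

(** * Rearranging Cauchy sums *)

(** The two sides cut the triangle i + j <= n along rows and along
    antidiagonals; increasing n adds one antidiagonal to either side. *)
Lemma sum_triangle (V : nmodType) (F : nat -> nat -> V) n :
  \sum_(i < n.+1) \sum_(j < (n - i).+1) F i j =
  \sum_(k < n.+1) \sum_(i < k.+1) F i (k - i)%N.
Proof.
elim: n => [|n IH]; first by rewrite !big_ord1.
rewrite [RHS]big_ord_recr /= -IH.
under eq_bigr do rewrite big_ord_recr /=.
rewrite big_split /=; congr (_ + _).
rewrite big_ord_recr /= subnn big_ord0 addr0.
by apply: eq_bigr => i _; rewrite subSn // -ltnS.
Qed.

Lemma sum_ord_widen (V : nmodType) (F : nat -> V) m n :
  (m <= n)%N -> (forall i, (m <= i)%N -> F i = 0) ->
  \sum_(i < n) F i = \sum_(i < m) F i.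
Proof.
move=> le_mn F0; rewrite (big_ord_widen n F le_mn).
rewrite [LHS](bigID (fun i : 'I_n => (i < m)%N)) /=.
by rewrite [X in _ + X]big1 ?addr0 // => i; rewrite -leqNgt => /F0.
Qed.

Lemma sum_rectangle (V : nmodType) (F : nat -> nat -> V) m n :
  (forall i j, (m <= i)%N || (n <= j)%N -> F i j = 0) ->
  \sum_(k < (m + n).+1) \sum_(i < k.+1) F i (k - i)%N =
  \sum_(i < m) \sum_(j < n) F i j.
Proof.
move=> F0; rewrite -sum_triangle.
rewrite (@sum_ord_widen _ (fun i => \sum_(j < (m + n - i).+1) F i j) m).
- apply: eq_bigr => i _; apply: sum_ord_widen => [|j le_nj].
    by rewrite -addnBAC ?(ltnW (ltn_ord i)) // leqW // leq_addl.
  by rewrite F0 // le_nj orbT.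
- by rewrite leqW // leq_addr.
- by move=> i le_mi; rewrite big1 // => j _; rewrite F0 // le_mi.
Qed.

(** * Polynomials with coefficients in a vector space *)

Section Coefs.
Variables (K : fieldType) (A : lmodType K).
Hypothesis charK : [pchar K] =i pred0.

(** The values at the distinct points 0, 1, ..., n-1 determine the
    coefficients, because the Vandermonde matrix of these points is
    invertible. *)
Lemma vector_poly_eq0 (c : nat -> A) n :
  (forall t : K, \sum_(i < n) t ^+ i *: c i = 0) ->
  forall i, (i < n)%N -> c i = 0.
Proof.
move=> c0 i lt_in; pose k := Ordinal lt_in.
pose V : 'M[K]_n := Vandermonde n (\row_(j < n) j%:R).
have V_unit : V \in unitmx.
  rewrite unitmxE unitfE det_Vandermonde.
  apply/prodf_neq0 => a _; apply/prodf_neq0 => b lt_ab.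
  rewrite !mxE -natrB ?(ltnW lt_ab) //.
  by move/pcharf0P: charK => ->; rewrite subn_eq0 -ltnNge.
have VW a : \sum_j V a j * invmx V j k = (a == k)%:R.
  by have /matrixP/(_ a k) := mulmxV V_unit; rewrite !mxE.
have -> : c i = \sum_(a < n) (\sum_j V a j * invmx V j k) *: c a.
  rewrite (bigD1 k) //= VW eqxx scale1r big1 ?addr0 // => a /negPf ak.
  by rewrite VW ak scale0r.
under eq_bigr do rewrite scaler_suml.
rewrite exchange_big big1 //= => j _.
transitivity (invmx V j k *: \sum_(a < n) j%:R ^+ a *: c a).
  by rewrite scaler_sumr; apply: eq_bigr => a _; rewrite !mxE scalerA mulrC.
by rewrite c0 scaler0.
Qed.

(** [f] lists the coefficients of the polynomial function [v]. A relation
    rather than an evaluation function, so that no degree bound has to be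
    carried along. *)
Definition coefs_of (f : nat -> A) (v : K -> A) : Prop :=
  exists n, (forall i, (n <= i)%N -> f i = 0) /\
            (forall t, v t = \sum_(i < n) t ^+ i *: f i).

Lemma coefs_of_widen f v : coefs_of f v ->
  exists n, forall m, (n <= m)%N ->
    (forall i, (m <= i)%N -> f i = 0) /\
    (forall t, v t = \sum_(i < m) t ^+ i *: f i).
Proof.
case=> n [f0 vE]; exists n => m le_nm; split=> [i le_mi|t].
  by apply: f0; apply: leq_trans le_mi.
rewrite vE; apply/esym; apply: (@sum_ord_widen _ (fun i => t ^+ i *: f i)) => //.
by move=> i /f0 ->; rewrite scaler0.
Qed.

Lemma coefs_of_inj f g v w : coefs_of f v -> coefs_of g w -> v =1 w -> f = g.
Proof.
move=> /coefs_of_widen[m fv] /coefs_of_widen[n gw] vw; apply/funext => i.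
have [f0 vE] := fv _ (leq_maxl m n); have [g0 wE] := gw _ (leq_maxr m n).
have [le_i|lt_i] := leqP (maxn m n) i; first by rewrite f0 // g0.
apply/eqP; rewrite -subr_eq0; apply/eqP.
apply: (@vector_poly_eq0 (fun j => f j - g j) (maxn m n)) lt_i => t.
under eq_bigr do rewrite scalerBr.
by rewrite sumrB -vE -wE vw subrr.
Qed.

Lemma coefs_of_const x : coefs_of (fseries_const x) (fun=> x).
Proof.
exists 1%N; split=> [[|i]|t] //.
by rewrite big_ord1 expr0 scale1r.
Qed.

Lemma coefs_of_add f g v w :
  coefs_of f v -> coefs_of g w -> coefs_of (f + g) (fun t => v t + w t).
Proof.
move=> /coefs_of_widen[m fv] /coefs_of_widen[n gw].
have [f0 vE] := fv _ (leq_maxl m n); have [g0 wE] := gw _ (leq_maxr m n).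
have fgE i : (f + g) i = f i + g i by [].
exists (maxn m n); split=> [i le_i|t]; first by rewrite fgE f0 // g0 // addr0.
rewrite vE wE -big_split; apply: eq_bigr => i _.
by rewrite fgE scalerDr.
Qed.

(** Evaluation at t is multiplicative. Taking for [F i j] a biadditive
    expression in two coefficients covers both formal linear maps and the
    extended bracket. *)
Lemma coefs_of_cauchy (F : nat -> nat -> A) m n :
  (forall i j, (m <= i)%N || (n <= j)%N -> F i j = 0) ->
  coefs_of (fun k => \sum_(i < k.+1) F i (k - i)%N)
           (fun t => \sum_(i < m) \sum_(j < n) t ^+ (i + j) *: F i j).
Proof.
move=> F0; exists (m + n).+1; split=> [k lt_k|t].
  rewrite big1 // => i _; apply: F0; apply: contraLR lt_k.
  rewrite negb_or -!ltnNge => /andP[lt_im lt_kn].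
  rewrite ltnS -(subnKC (leq_ord i)).
  by apply: leq_add; apply: ltnW.
rewrite -(@sum_rectangle _ (fun i j => t ^+ (i + j) *: F i j)).
  apply: eq_bigr => k _; rewrite scaler_sumr; apply: eq_bigr => i _.
  by rewrite subnKC ?leq_ord.
by move=> i j /F0 ->; rewrite scaler0.
Qed.

Lemma coefs_of_lin (al : nat -> A -> A) d f v :
  (forall i, linear (al i)) -> (forall i x, (d <= i)%N -> al i x = 0) ->
  coefs_of f v ->
  coefs_of (fseries_lin al f) (fun t => \sum_(i < d) t ^+ i *: al i (v t)).
Proof.
move=> al_lin al0 [n [f0 vE]].
have := @coefs_of_cauchy (fun i j => al i (f j)) d n.
case=> [i j /orP[/al0 //|/f0 ->]|N [suppN valN]]; first exact: linear_fun0.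
exists N; split=> // t; rewrite -valN; apply: eq_bigr => i _.
rewrite vE linear_fun_sum // scaler_sumr; apply: eq_bigr => j _.
by rewrite linear_funZ // scalerA exprD.
Qed.

Lemma fseries_bilin_extE (br : A -> A -> A) f g k :
  fseries_bilin_ext br f g k = \sum_(j < k.+1) br (f j) (g (k - j)%N).
Proof.
rewrite /fseries_bilin_ext /fseries_bilin big_ord_recl /= subn0.
by rewrite [X in _ + X]big1 ?addr0 // => i _; rewrite big1.
Qed.

Lemma coefs_of_bracket (br : A -> A -> A) f g v w :
  bilinear_for *:%R *:%R br -> coefs_of f v -> coefs_of g w ->
  coefs_of (fseries_bilin_ext br f g) (fun t => br (v t) (w t)).
Proof.
move=> [br_l br_r] [m [f0 vE]] [n [g0 wE]].
have := @coefs_of_cauchy (fun i j => br (f i) (g j)) m n.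
case=> [i j /orP[/f0|/g0] ->|N [suppN valN]].
- exact: (linear_fun0 (br_l (g j))).
- exact: (linear_fun0 (br_r (f i))).
exists N; split=> [i|t]; first by rewrite fseries_bilin_extE; apply: suppN.
under [RHS]eq_bigr do rewrite fseries_bilin_extE.
rewrite -valN vE (linear_fun_sum _ _ _ (br_l (w t))).
apply: eq_bigr => i _ /=; rewrite wE (linear_fun_sum _ _ _ (br_r _)).
apply: eq_bigr => j _ /=; rewrite (linear_funZ _ (br_r _)).
by rewrite (linear_funZ _ (br_l (g j))) scalerA mulrC exprD.
Qed.

End Coefs.

(** * K[[t]]-linear maps on A[[t]] *)

Section FormalMaps.
Variables (K : fieldType) (A : lmodType K).

Lemma fseries_lin_comp (a b : nat -> A -> A) (f : nat -> A) :
  (forall i, linear (a i)) ->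
  fseries_lin a (fseries_lin b f) =
  fseries_lin (fun l x => \sum_(i < l.+1) a i (b (l - i)%N x)) f.
Proof.
move=> a_lin; apply/funext => k; rewrite /fseries_lin.
under eq_bigr do rewrite linear_fun_sum //.
rewrite (@sum_triangle _ (fun i j => a i (b j (f (k - i - j)%N)))).
apply: eq_bigr => l _; apply: eq_bigr => i _.
by rewrite -subnDA subnKC ?leq_ord.
Qed.

Lemma fseries_lin_iter (a : nat -> A -> A) m :
  (forall i, linear (a i)) -> a 0%N =1 id ->
  exists b : nat -> A -> A,
    [/\ forall i, linear (b i), b 0%N =1 id
      & forall f, iter m (fseries_lin a) f = fseries_lin b f].
Proof.
move=> a_lin a0; elim: m => [|m [b [b_lin b0 bE]]].
  exists (fun i x => if i == 0%N then x else 0); split=> // [[|i] c x y //=|f].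
    by rewrite scaler0 addr0.
  apply/funext => k; rewrite /fseries_lin big_ord_recl /= subn0 big1 ?addr0 //.
exists (fun l x => \sum_(i < l.+1) a i (b (l - i)%N x)); split=> [l|x|f].
- by apply: linear_sum_fun => i _; apply: (linear_comp (a_lin i)).
- by rewrite big_ord1 a0 b0.
- by rewrite iterS bE fseries_lin_comp.
Qed.

Lemma fseries_lin_bracket (a : nat -> A -> A) (br : A -> A -> A) f g :
  (forall i, linear (a i)) ->
  fseries_lin a (fseries_bilin_ext br f g) =
  fseries_bilin (fun i x y => a i (br x y)) f g.
Proof.
move=> a_lin; apply/funext => k; apply: eq_bigr => i _.
by rewrite fseries_bilin_extE linear_fun_sum.
Qed.

Lemma fseries_lin_opp (a : nat -> A -> A) f :
  (forall i, linear (a i)) -> fseries_lin a (- f) = - fseries_lin a f.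
Proof.
move=> a_lin; apply/funext => k.
have -> : (- fseries_lin a f) k = - fseries_lin a f k by [].
rewrite /fseries_lin -sumrN.
by apply: eq_bigr => i _; rewrite -(linear_funN (a_lin i)).
Qed.

Lemma fseries_bilin_ext_skew (br : A -> A -> A) :
  skewsymmetric br -> skewsymmetric (fseries_bilin_ext br).
Proof.
move=> br_skew f g; apply/funext => k.
have -> : (- fseries_bilin_ext br g f) k = - fseries_bilin_ext br g f k by [].
rewrite !fseries_bilin_extE -sumrN.
rewrite (reindex_inj rev_ord_inj); apply: eq_bigr => j _ /=.
by rewrite subSS subKn ?leq_ord // -br_skew.
Qed.

End FormalMaps.

(** * Twisting a Malcev algebra by an endomorphism *)

Section Twist.
Variables (K : fieldType) (A : lmodType K) (br : A -> A -> A).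
Hypothesis malcev_br : is_malcev br.

(** Moving [be] out of the brackets, the Hom-Jacobiator of the twisted bracket
    is [be^2] of the Jacobiator, so that each side of the Hom-Malcev identity
    is [be^3] of the same side of the Malcev identity. *)
Lemma twist_hom_malcev (be : A -> A) :
  linear be -> {morph be : x y / br x y} ->
  is_hom_malcev (twisted_bracket be br) be.
Proof.
move=> be_lin beM; case: malcev_br => [[br_l br_r] br_skew _ br_malcev].
have be_jac x y z :
    be (hom_jacobiator br id x y z) = hom_jacobiator br id (be x) (be y) (be z).
  by rewrite /hom_jacobiator !linear_funD // !beM.
have twist_jac x y z :
    hom_jacobiator (twisted_bracket be br) be x y z =
    be (be (hom_jacobiator br id x y z)).
  by rewrite /hom_jacobiator /twisted_bracket /= -!beM -!linear_funD.
split=> // [|x y|x y z].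
- split=> u c x y; rewrite /twisted_bracket -be_lin; congr (be _).
    exact: br_l.
  exact: br_r.
- by rewrite /twisted_bracket br_skew linear_funN.
- rewrite /hom_malcev_identity !twist_jac /twisted_bracket -!beM -be_jac.
  by rewrite br_malcev.
Qed.

Lemma iter_morph (be : A -> A) m :
  {morph be : x y / br x y} -> {morph iter m be : x y / br x y}.
Proof. by move=> beM; elim: m => // m IH x y; rewrite /= IH beM. Qed.

End Twist.

(** * The deformation attached to an iterate of alpha_t *)

Section Deformation.
Variables (K : fieldType) (A : lmodType K) (br : A -> A -> A).
Variables (p : nat) (al : nat -> A -> A).
Hypotheses (charK : [pchar K] =i pred0) (malcev_br : is_malcev br).
Hypothesis al_linear : forall i : nat, (1 <= i <= p)%N -> linear (al i).
Hypothesis alpha_endo : forall t : K, {morph alpha_at p al t : x y / br x y}.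

Let alpha_coef (i : nat) (x : A) : A :=
  if i == 0%N then x else if (i <= p)%N then al i x else 0.

Let alpha_coef_linear i : linear (alpha_coef i).
Proof.
move=> c x y; rewrite /alpha_coef; case: i => //= i.
by case: ifP => [le_ip|_]; [apply: al_linear | rewrite scaler0 addr0].
Qed.

Lemma alpha_atE (t : K) x :
  alpha_at p al t x = \sum_(i < p.+1) t ^+ i *: alpha_coef i x.
Proof.
rewrite big_ord_recl expr0 scale1r /alpha_at big_add1 big_mkord /=.
by congr (_ + _); apply: eq_bigr => i _; rewrite /alpha_coef /= ltn_ord.
Qed.

Lemma alpha_at_linear (t : K) : linear (alpha_at p al t).
Proof.
have -> : alpha_at p al t = fun x => \sum_(i < p.+1) t ^+ i *: alpha_coef i x.
  by apply/funext => x; rewrite alpha_atE.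
apply: linear_sum_fun => i _ c x y.
by rewrite alpha_coef_linear scalerDr !scalerA mulrC.
Qed.

Lemma coefs_of_alpha_formal m f (v : K -> A) :
  coefs_of f v ->
  coefs_of (iter m (alpha_formal p al) f)
           (fun t => iter m (alpha_at p al t) (v t)).
Proof.
move=> fv; elim: m => //= m IH.
have [|N [suppN valN]] := @coefs_of_lin _ _ alpha_coef p.+1 _ _ alpha_coef_linear _ IH.
  by case=> // i x; rewrite /alpha_coef /= => le_i; rewrite leqNgt le_i.
by exists N; split=> // t; rewrite alpha_atE.
Qed.

Lemma iter_alpha_deformation m :
  is_deformation br id
    (fun f g => iter m (alpha_formal p al) (fseries_bilin_ext br f g))
    (iter m (alpha_formal p al)).
Proof.
have [br_bilin br_skew _ _] := malcev_br.
have [b [b_lin b0 bE]] := fseries_lin_iter m alpha_coef_linear (fun=> erefl).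
split=> //.
- exists (fun i x y => b i (br x y)); split=> // [i|f g].
    have [br_l br_r] := br_bilin.
    split=> u c x y; rewrite -b_lin; congr (b i _); first exact: br_l.
    exact: br_r.
  by rewrite bE fseries_lin_bracket.
- by exists b.
- by move=> f g; rewrite !bE fseries_bilin_ext_skew // fseries_lin_opp.
move=> x y z.
have twist_t t := hom_malcevP
  (twist_hom_malcev malcev_br (linear_iter m (alpha_at_linear t))
     (iter_morph m (alpha_endo t))) x y z.
(* Both sides are polynomials in t, whose values at t are the two sides of
   [twist_t t]; the evaluations are computed along the shape of the terms. *)
have cA := coefs_of_alpha_formal m.
have cB f g v w fv gw := cA _ _ (@coefs_of_bracket K A br f g v w br_bilin fv gw).
have cJ f g h u v w fu gv hw := coefs_of_add
  (coefs_of_add (cB _ _ _ _ (cB f g u v fu gv) (cA h w hw))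
                (cB _ _ _ _ (cB _ _ _ _ gv hw) (cA _ _ fu)))
  (cB _ _ _ _ (cB _ _ _ _ hw fu) (cA _ _ gv)).
have cx := @coefs_of_const K A x; have cy := @coefs_of_const K A y.
have cz := @coefs_of_const K A z.
apply: (coefs_of_inj charK _ _ twist_t).
  exact: (cJ _ _ _ _ _ _ (cA _ _ cx) (cA _ _ cy) (cB _ _ _ _ cx cz)).
exact: (cB _ _ _ _ (cJ _ _ _ _ _ _ cx cy cz) (cA _ _ (cA _ _ cx))).
Qed.

End Deformation.

(** * The deformation and its derived Hom-algebras *)

Theorem proposition5p4 (K : closedFieldType) (charK : [pchar K] =i pred0)
    (A : lmodType K) (br : A -> A -> A) (malcev_br : is_malcev br)
    (p : nat) (al : nat -> A -> A)
    (al_linear : forall i : nat, (1 <= i <= p)%N -> linear (al i))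
    (alpha_endo : forall (t : K) (x y : A),
       alpha_at p al t (br x y) = br (alpha_at p al t x) (alpha_at p al t y)) :
  let alpha_t := alpha_formal p al in
  let br_t := twisted_bracket alpha_t (fseries_bilin_ext br) in
  [/\ forall t : K,
        is_hom_malcev (twisted_bracket (alpha_at p al t) br) (alpha_at p al t),
      is_deformation br id br_t alpha_t
    & forall n : nat,
        is_deformation br id (derived2_bracket n br_t alpha_t)
          (derived2_twist n alpha_t)].
Proof.
move=> alpha_t br_t.
have deform := iter_alpha_deformation charK malcev_br al_linear alpha_endo.
split=> [t||n].
- exact: twist_hom_malcev (alpha_at_linear al_linear t) (alpha_endo t).
- exact: (deform 1%N).
have -> : derived2_bracket n br_t alpha_t =
    fun f g => iter (2 ^ n) alpha_t (fseries_bilin_ext br f g).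
  apply/funext => f; apply/funext => g.
  rewrite /derived2_bracket /br_t /twisted_bracket -iterSr subn1 prednK //.
  by rewrite expn_gt0.
exact: deform.
Qed.
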